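(* Let $\Gamma=(\gamma_n)_{n\ge1}$ be a sequence of distinct complex numbers satisfying the sparseness condition $\inf_{n\ge1}|\gamma_{n+1}|/|\gamma_n|>1$, and let $v=(v_n)_{n\ge1}$ be a sequence of positive numbers that is admissible for $\Gamma$, i.e. $\sum_{n=1}^\infty v_n/(1+|\gamma_n|^2)<\infty$. Let $\mu$ be a nonnegative measure on $\mathbb{C}$ with $\mu(\Gamma)=0$. Then the map $H_{(\Gamma,v)}$ is bounded from $\ell^2_v$ to $L^2(\mathbb{C},\mu)$ if and only if \[ \sup_{n\ge1}\int_{\Omega_n}\frac{v_n\,d\mu(z)}{|z-\gamma_n|^2}<\infty \] and \[ \sup_{n\ge1}\left(\sum_{l=1}^{n}v_l\sum_{m=n+1}^\infty\int_{\Omega_m}\frac{d\mu(z)}{|z|^2}+\sum_{m=1}^{n}\mu(\Omega_m)\sum_{l=n+1}^\infty\frac{v_l}{|\gamma_l|^2}\right)<\infty. \]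
   Context: $\ell^2_v=\{a=(a_n)_{n\ge1}:\ \|a\|_v^2=\sum_n|a_n|^2v_n<\infty\}$. For $a\in\ell^2_v$ and $z\in\mathbb{C}\setminus\Gamma$, $H_{(\Gamma,v)}a(z)=\sum_{n=1}^\infty \frac{a_nv_n}{z-\gamma_n}$ (under the admissibility and sparseness conditions this series converges absolutely for every $z\in\mathbb{C}\setminus\Gamma$). The sets $\Omega_n$ partition $\mathbb{C}$: $\Omega_1=\{z:|z|<(|\gamma_1|+|\gamma_2|)/2\}$ and, for $n\ge2$, $\Omega_n=\{z:(|\gamma_{n-1}|+|\gamma_n|)/2\le|z|<(|\gamma_n|+|\gamma_{n+1}|)/2\}$. *)

(* Defs.v *)
From HB Require Import structures.
From mathcomp Require Import all_boot all_order all_algebra.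
From mathcomp Require Import all_classical all_reals all_analysis.
From mathcomp Require Import complex.
Set Implicit Arguments. Unset Strict Implicit. Unset Printing Implicit Defensive.
Import Order.TTheory GRing.Theory Num.Theory.
Local Open Scope classical_set_scope.
Local Open Scope ring_scope.

(* The complex plane, as a measurable space, is R * R with its product
   (Borel) sigma-algebra; a point (x, y) is identified with x + i y. *)
Definition toC (R : realType) (z : (R * R)%type) : R[i] := (z.1 +i* z.2)%C.

Definition cabs (R : realType) (w : R[i]) : R :=
  Num.sqrt (complex.Re w ^+ 2 + complex.Im w ^+ 2).

(* The annuli Omega_n (0-based: paper's Omega_{n+1} is our Omega n). *)
Definition Omega (R : realType) (g : nat -> R[i]) (n : nat) : set (R * R) :=
  match n with
  | 0 => [set z | cabs (toC z) < (cabs (g 0%N) + cabs (g 1%N)) / 2]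
  | k.+1 => [set z | (cabs (g k) + cabs (g n)) / 2 <= cabs (toC z)
                     /\ cabs (toC z) < (cabs (g n) + cabs (g n.+1)) / 2]
  end.

Definition ell2v_norm2 (R : realType) (v : nat -> R) (a : nat -> R[i]) : \bar R :=
  (\sum_(0 <= n <oo) ((cabs (a n)) ^+ 2 * v n)%:E)%E.

Definition Hterm (R : realType) (g : nat -> R[i]) (v : nat -> R) (a : nat -> R[i])
  (z : (R * R)%type) (n : nat) : R[i] :=
  a n * ((v n)%:C)%C / (toC z - g n).

Definition Hop (R : realType) (g : nat -> R[i]) (v : nat -> R) (a : nat -> R[i])
  (z : (R * R)%type) : R[i] :=
  ((limn (fun N => \sum_(0 <= n < N) complex.Re (Hterm g v a z n))) +i*
   (limn (fun N => \sum_(0 <= n < N) complex.Im (Hterm g v a z n))))%C.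

Definition H_bounded (R : realType) (mu : {measure set (R * R)%type -> \bar R})
  (g : nat -> R[i]) (v : nat -> R) : Prop :=
  exists C : R, forall a : nat -> R[i],
    (ell2v_norm2 v a < +oo)%E ->
    (\int[mu]_z ((cabs (Hop g v a z)) ^+ 2)%:E <= C%:E * ell2v_norm2 v a)%E.

(* Main.v *)
Require Import Defs.
From HB Require Import structures.
From mathcomp Require Import all_boot all_order all_algebra.
From mathcomp Require Import all_classical all_reals all_analysis.
From mathcomp Require Import complex measurable_realfun ring lra.
Set Implicit Arguments. Unset Strict Implicit. Unset Printing Implicit Defensive.
Import Order.TTheory GRing.Theory Num.Theory.
Local Open Scope classical_set_scope.
Local Open Scope ring_scope.

(* On Omega_n sparseness makes |z - gamma_l| comparable to |z| for l < n and to
   |gamma_l| for l > n.  So |Ha| is controlled on Omega_n by its n-th term, by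
   (1/|z|) sum_{l<n} |a_l| v_l and by sum_{l>n} |a_l| v_l / |gamma_l|: the first
   condition bounds the diagonal part, the second one is the Muckenhoupt
   condition for the two discrete Hardy inequalities that bound the rest.
   Everything is done for finite sums, and Fatou's lemma gives the general case.
   Conversely, test H on a basis vector, on the indicator of {l <= n}, and on
   a_l = -gamma_l / |gamma_l|^2 for n < l < L.  Since Re (x / (x - y)) >= 1/2
   when |y| <= |x|, there is no cancellation in Ha for the last two. *)

(** * Discrete Hardy inequalities *)

Section Hardy.
Variable R : realFieldType.
Implicit Types (a v w b u : nat -> R) (K n l : nat) (M : R).

Local Notation psum v n := (\sum_(0 <= i < n) v i).
Local Notation mean a v n := (psum (fun i => a i * v i) n / psum v n).

Lemma psum_gt0 v n : (forall l, 0 < v l) -> 0 < psum v n.+1.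
Proof.
move=> v0; rewrite big_nat_recl // ltr_pwDl ?v0 //.
by apply: sumr_ge0 => i _; exact: ltW.
Qed.

(** With V_n the partial sums of [v] and m_n the means, the potential is V_n m_n^2. As a_n v_n =
    V_{n+1} m_{n+1} - V_n m_n, each induction step loses exactly V_n (m_{n+1} - m_n)^2, which is
    nonnegative. *)
Lemma hardy_mean_telescope a v n : (forall l, 0 < v l) ->
  \sum_(0 <= l < n) ((mean a v l.+1) ^+ 2 - 2 * mean a v l.+1 * a l) * v l
    <= - ((psum (fun i => a i * v i) n) ^+ 2 / psum v n).
Proof.
move=> v0; elim: n => [|n IHn].
  by rewrite !big_nil expr0n mul0r oppr0.
rewrite big_nat_recr //=; apply: le_trans (lerD IHn (lexx _)) _.
have V'0 := psum_gt0 n v0.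
have Eavn : psum (fun i => a i * v i) n.+1 = psum (fun i => a i * v i) n + a n * v n.
  by rewrite big_nat_recr.
have EVn : psum v n.+1 = psum v n + v n by rewrite big_nat_recr.
(* For n = 0 the mean divides by zero; the identity survives because both sums are empty. *)
have Eb : psum (fun i => a i * v i) n = psum v n * mean a v n.
  case: n {IHn Eavn EVn V'0} => [|n]; first by rewrite !big_nil mul0r.
  by rewrite mulrC divfK // gt_eqF // psum_gt0.
have Es : (psum (fun i => a i * v i) n) ^+ 2 / psum v n = psum v n * (mean a v n) ^+ 2.
  by rewrite expr2 -mulrA {1}Eb expr2 -mulrA; congr (_ * _); rewrite mulrA.
have Ea : psum (fun i => a i * v i) n.+1 = psum v n.+1 * mean a v n.+1.
  by rewrite mulrC divfK // gt_eqF.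
have Es' : (psum (fun i => a i * v i) n.+1) ^+ 2 / psum v n.+1 = psum v n.+1 * (mean a v n.+1) ^+ 2.
  by rewrite expr2 -mulrA {1}Ea expr2 -mulrA; congr (_ * _); rewrite mulrA.
have Vn : 0 <= psum v n by apply: sumr_ge0 => i _; exact: ltW.
rewrite Es Es'.
have H : a n * v n = psum v n.+1 * mean a v n.+1 - psum v n * mean a v n.
  by rewrite -Ea -Eb Eavn; ring.
move: (mean a v n) (mean a v n.+1) H => be al H.
have -> : (al ^+ 2 - 2 * al * a n) * v n = al ^+ 2 * v n - 2 * al * (a n * v n).
  by ring.
rewrite H EVn -subr_ge0.
rewrite [X in 0 <= X](_ : _ = psum v n * (al - be) ^+ 2); last by ring.
by rewrite mulr_ge0 // sqr_ge0.
Qed.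

(** The telescoped sum is at most 0, and 0 <= (m - 2 a)^2 gives 2 m a - 4 a^2 <= m^2 - 2 m a, which
    takes the place of Cauchy-Schwarz. *)
Lemma hardy_mean a v n : (forall l, 0 < v l) ->
  \sum_(0 <= l < n) mean a v l.+1 * a l * v l <=
    2 * \sum_(0 <= l < n) a l ^+ 2 * v l.
Proof.
move=> v0; have := hardy_mean_telescope a n v0.
have : 0 <= (psum (fun i => a i * v i) n) ^+ 2 / psum v n.
  by rewrite divr_ge0 ?sqr_ge0 ?sumr_ge0 // => i _; exact: ltW.
rewrite -oppr_le0 => X0 H; have {X0 H}H := le_trans H X0.
have H2 : \sum_(0 <= l < n) (2 * (mean a v l.+1 * a l * v l) - 4 * (a l ^+ 2 * v l))
   <= \sum_(0 <= l < n) ((mean a v l.+1) ^+ 2 - 2 * mean a v l.+1 * a l) * v l.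
  apply: ler_sum => l _; have vl := ltW (v0 l).
  rewrite -subr_ge0 [X in 0 <= X](_ : _ = (mean a v l.+1 - 2 * a l) ^+ 2 * v l).
    by rewrite mulr_ge0 // sqr_ge0.
  by ring.
have {H2}H := le_trans H2 H.
move: H; rewrite sumrB -!mulr_sumr => H; lra.
Qed.

(** Abel summation: each square is the sum of its increments, and exchanging the two sums attaches
    to an increment the tail of [w] beyond it. *)
Lemma sum_by_tails w a K (A := fun n => psum a n) :
  \sum_(0 <= n < K) w n * A n ^+ 2 =
  \sum_(0 <= l < K) (A l.+1 ^+ 2 - A l ^+ 2) * \sum_(l.+1 <= n < K) w n.
Proof.
elim: K => [|K IHK]; first by rewrite !big_nil.
rewrite big_nat_recr //= IHK big_nat_recr //= [\sum_(K.+1 <= n < K.+1) w n]big_geq // mulr0 addr0.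
have -> : A K ^+ 2 = \sum_(0 <= l < K) (A l.+1 ^+ 2 - A l ^+ 2).
  by rewrite telescope_sumr // [A 0%N]/A big_nil expr0n subr0.
rewrite mulr_sumr -big_split /=.
apply: eq_big_nat => l /andP[_ lK].
by rewrite [in RHS]big_nat_recr //= [RHS]mulrDr; congr (_ + _); rewrite mulrC.
Qed.

(* Summation by parts moves the tails of [w] next to the partial sums of [v],
   whose product is at most [M]; what remains is the inequality for means. *)
Lemma hardy a v w K M : 0 <= M -> (forall l, 0 <= a l) -> (forall l, 0 < v l) ->
  (forall n, 0 <= w n) ->
  (forall n, (n.+1 < K)%N -> psum v n.+1 * \sum_(n.+1 <= m < K) w m <= M) ->
  \sum_(0 <= n < K) w n * (\sum_(0 <= l < n) a l * v l) ^+ 2 <=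
    4 * M * \sum_(0 <= l < K) a l ^+ 2 * v l.
Proof.
move=> M0 a0 v0 w0 H; rewrite sum_by_tails.
have -> : 4 * M * \sum_(0 <= l < K) a l ^+ 2 * v l =
          2 * M * (2 * \sum_(0 <= l < K) a l ^+ 2 * v l) by ring.
have M2 : 0 <= 2 * M by rewrite mulr_ge0.
apply: le_trans (ler_wpM2l M2 (hardy_mean a K v0)).
rewrite mulr_sumr; apply: ler_sum_nat => l /andP[_ lK].
have av n : 0 <= psum (fun i => a i * v i) n.
  by apply: sumr_ge0 => i _; rewrite mulr_ge0 // ltW.
have V0 := psum_gt0 l v0.
set T := \sum_(_ <= _ < _) w _.
have T0 : 0 <= T by apply: sumr_ge0.
have VT : psum v l.+1 * T <= M.
  have [lK'|lK'] := ltnP l.+1 K; first exact: H.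
  by rewrite (_ : T = 0) ?mulr0 // /T big_geq.
have Emean : psum (fun i => a i * v i) l.+1 = psum v l.+1 * mean a v l.+1.
  by rewrite mulrC divfK // gt_eqF.
have m0 : 0 <= mean a v l.+1 by rewrite divr_ge0 // ltW.
have Er : psum (fun i => a i * v i) l = psum (fun i => a i * v i) l.+1 - a l * v l.
  by rewrite big_nat_recr //= addrK.
(* For consecutive partial sums, x^2 - y^2 <= 2 x (x - y), the gap being (x - y)^2. *)
apply: (@le_trans _ _ (2 * psum (fun i => a i * v i) l.+1 * (a l * v l) * T)).
  apply: ler_wpM2r => //; rewrite Er.
  rewrite -subr_ge0 [X in 0 <= X](_ : _ = (a l * v l) ^+ 2) ?sqr_ge0 //.
  by ring.
rewrite [in leLHS]Emean.
have c0 : 0 <= 2 * (mean a v l.+1 * a l * v l).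
  by rewrite mulr_ge0 // mulr_ge0 ?(ltW (v0 _)) // mulr_ge0.
have -> : 2 * (psum v l.+1 * mean a v l.+1) * (a l * v l) * T =
   (2 * (mean a v l.+1 * a l * v l)) * (psum v l.+1 * T) by ring.
apply: le_trans (ler_wpM2l c0 VT) _.
by rewrite le_eqVlt; apply/orP; left; apply/eqP; ring.
Qed.

Lemma sum_nat_rev (F : nat -> R) K n : (n <= K)%N ->
  \sum_(0 <= i < n) F (K - i.+1)%N = \sum_(K - n <= i < K) F i.
Proof.
elim: n => [|n IHn] nK; first by rewrite big_nil subn0 big_geq.
rewrite big_nat_recr //= IHn ?(ltnW nK) // [RHS]big_ltn ?ltn_subrL ?(leq_trans _ nK) //.
by rewrite addrC subnSK.
Qed.

(** Reversing the order by [i |-> K - i.+1] exchanges initial sums and tails, so this is [hardy]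
    read backwards. *)
Lemma hardy_dual b u w K M : 0 <= M -> (forall l, 0 <= b l) -> (forall l, 0 < u l) ->
  (forall n, 0 <= w n) ->
  (forall n, (n.+1 < K)%N -> psum w n.+1 * \sum_(n.+1 <= m < K) u m <= M) ->
  \sum_(0 <= n < K) w n * (\sum_(n.+1 <= l < K) b l * u l) ^+ 2 <=
    4 * M * \sum_(0 <= l < K) b l ^+ 2 * u l.
Proof.
move=> M0 b0 u0 w0 H.
have rev_all F : \sum_(0 <= i < K) F i = \sum_(0 <= i < K) F (K - i.+1)%N :> R.
  by rewrite sum_nat_rev // subnn.
have := @hardy (fun i => b (K - i.+1)%N) (fun i => u (K - i.+1)%N)
  (fun i => w (K - i.+1)%N) K M M0.
rewrite -(rev_all (fun l => b l ^+ 2 * u l)) => hK.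
rewrite rev_all; apply: le_trans (hK _ _ _ _) => //; last first.
  move=> n nK; rewrite (sum_nat_rev u) ?(ltnW nK) //.
  (* Both sides complete the last [n.+1] values of [w] to the full sum. *)
  have E : \sum_(n.+1 <= m < K) w (K - m.+1)%N = psum w (K - n.+1).
    have := sum_nat_rev w (leqnn K); rewrite subnn.
    rewrite (@big_cat_nat _ _ _ n.+1 0 K) ?(ltnW nK) //=.
    rewrite sum_nat_rev ?(ltnW nK) // [X in _ = X -> _](@big_cat_nat _ _ _ (K - n.+1)) ?leq_subr //=.
    by rewrite addrC => /addIr.
  rewrite E mulrC.
  have nK' : (K - n.+1 = (K - n.+2).+1)%N by rewrite subnSK.
  rewrite nK'; apply: H; rewrite -nK' ltn_subrL /=.
  exact: leq_trans nK.
apply: ler_sum_nat => n /andP[_ nK].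
by rewrite (sum_nat_rev (fun l => b l * u l)) ?(ltnW nK) // subnSK.
Qed.

End Hardy.

(** * The complex modulus *)

Section ComplexAbs.
Variable R : realType.
Implicit Types x y w : R[i].

(** The norm of [R[i]] takes its values in [R[i]]. This embedding and the injectivity of [%:C]
    transfer its laws to the real-valued [cabs]. *)
Lemma cabsE w : (cabs w)%:C%C = `|w|.
Proof. by case: w. Qed.

Lemma sqr_cabs w : cabs w ^+ 2 = complex.Re w ^+ 2 + complex.Im w ^+ 2.
Proof. by rewrite sqr_sqrtr // addr_ge0 ?sqr_ge0. Qed.

Lemma cabs_ge0 w : 0 <= cabs w. Proof. exact: sqrtr_ge0. Qed.

Lemma cabsM x y : cabs (x * y) = cabs x * cabs y.
Proof. by apply: complexI; rewrite rmorphM /= !cabsE normrM. Qed.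

Lemma cabsV x : cabs x^-1 = (cabs x)^-1.
Proof. by apply: complexI; rewrite fmorphV /= !cabsE normfV. Qed.

Lemma cabsN x : cabs (- x) = cabs x.
Proof. by apply: complexI; rewrite !cabsE normrN. Qed.

Lemma cabs_real (r : R) : cabs r%:C%C = `|r|.
Proof. by rewrite /cabs /= expr0n addr0 sqrtr_sqr. Qed.

Lemma cabs0 : cabs (0 : R[i]) = 0.
Proof. by rewrite -[0]/(0%:C)%C cabs_real normr0. Qed.

Lemma cabs1 : cabs (1 : R[i]) = 1.
Proof. by rewrite -[1]/(1%:C)%C cabs_real normr1. Qed.

Lemma ler_cabsD x y : cabs (x + y) <= cabs x + cabs y.
Proof. by rewrite -lecR rmorphD /= !cabsE ler_normD. Qed.

Lemma lerB_cabs x y : cabs x - cabs y <= cabs (x - y).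
Proof. by rewrite lerBlDr; have := ler_cabsD (x - y) y; rewrite subrK. Qed.

Lemma cabsB x y : cabs (x - y) = cabs (y - x).
Proof. by rewrite -cabsN opprB. Qed.

Lemma cabs_eq0 x : (cabs x == 0) = (x == 0).
Proof. by rewrite -(inj_eq (@complexI R)) cabsE normr_eq0. Qed.

Lemma cabs_gt0 x : (0 < cabs x) = (x != 0).
Proof. by rewrite lt_def cabs_ge0 andbT cabs_eq0. Qed.

Lemma ler_cabs_sum (F : nat -> R[i]) m n :
  cabs (\sum_(m <= i < n) F i) <= \sum_(m <= i < n) cabs (F i).
Proof.
elim/big_ind2: _ => //; first by rewrite cabs0.
by move=> x1 x2 y1 y2 h1 h2; rewrite (le_trans (ler_cabsD _ _)) // lerD.
Qed.

Lemma ler_Re_cabs w : complex.Re w <= cabs w.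
Proof.
rewrite (le_trans (ler_norm _)) // -sqrtr_sqr ler_wsqrtr //.
by rewrite lerDl sqr_ge0.
Qed.

Lemma ler_normRe_cabs w : `|complex.Re w| <= cabs w.
Proof. by rewrite -sqrtr_sqr ler_wsqrtr // lerDl sqr_ge0. Qed.

Lemma ler_normIm_cabs w : `|complex.Im w| <= cabs w.
Proof. by rewrite -sqrtr_sqr ler_wsqrtr // lerDr sqr_ge0. Qed.

Lemma Re_sum (F : nat -> R[i]) m n :
  complex.Re (\sum_(m <= i < n) F i) = \sum_(m <= i < n) complex.Re (F i).
Proof. by apply: (big_morph (@complex.Re R)) => // -[? ?] [? ?]. Qed.

Lemma Im_sum (F : nat -> R[i]) m n :
  complex.Im (\sum_(m <= i < n) F i) = \sum_(m <= i < n) complex.Im (F i).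
Proof. by apply: (big_morph (@complex.Im R)) => // -[? ?] [? ?]. Qed.

Lemma ReZ (r : R) w : complex.Re (r%:C%C * w) = r * complex.Re w.
Proof. by case: w => a b /=; rewrite mul0r subr0. Qed.

(** True also for y = 0, both sides being 0, so the measurability of the terms below requires no
    case split at the poles. *)
Lemma Re_div x y : complex.Re (x / y) =
  (complex.Re x * complex.Re y + complex.Im x * complex.Im y)
    / (complex.Re y ^+ 2 + complex.Im y ^+ 2).
Proof. by case: x y => a b [c d] /=; ring. Qed.

Lemma Im_div x y : complex.Im (x / y) =
  (complex.Im x * complex.Re y - complex.Re x * complex.Im y)
    / (complex.Re y ^+ 2 + complex.Im y ^+ 2).
Proof. by case: x y => a b [c d] /=; ring. Qed.

(* The map [u |-> 1 / (1 - u)] sends the unit disc into [Re >= 1/2]. *)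
Lemma Re_div_ge_half x y : cabs y <= cabs x -> x != y ->
  1 / 2 <= complex.Re (x / (x - y)).
Proof.
move=> yx; rewrite -subr_eq0 -cabs_eq0 -sqrf_eq0 => xy0.
have D0 : 0 < cabs (x - y) ^+ 2 by rewrite lt_def xy0 sqr_ge0.
have : cabs y ^+ 2 <= cabs x ^+ 2 by rewrite ler_sqr ?nnegrE ?cabs_ge0.
move: D0; rewrite Re_div -sqr_cabs => D0.
rewrite ler_pdivlMr //; move: D0.
rewrite !sqr_cabs; case: x y {yx xy0} => a b [c d] /= _.
by rewrite !expr2 => H; lra.
Qed.

End ComplexAbs.

(** * The annuli *)

Section Annuli.
Variables (R : realType) (g : nat -> R[i]) (q : R).
Hypotheses (g_neq0 : forall n, g n != 0) (q_gt1 : 1 < q).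
Hypothesis g_sparse : forall n, q <= cabs (g n.+1) / cabs (g n).
Implicit Types (z : (R * R)%type) (l m n : nat).

Local Notation r n := (cabs (g n)).

Lemma r_gt0 n : 0 < r n. Proof. by rewrite cabs_gt0. Qed.

Lemma r_step n : q * r n <= r n.+1.
Proof. by rewrite -ler_pdivlMr ?r_gt0. Qed.

Lemma r_ltS n : r n < r n.+1.
Proof.
by rewrite (lt_le_trans _ (r_step n)) // ltr_pMl ?r_gt0.
Qed.

Lemma r_mono : {homo (fun n => r n) : m n / (m <= n)%N >-> m <= n}.
Proof. by apply: homo_leq => // [x|n]; [exact: le_trans|exact/ltW/r_ltS]. Qed.

(** The radii dominate q^n r_0, and q^n >= n (q - 1) in the manner of Bernoulli. The annuli cover
    the plane for this reason. *)
Lemma r_unbounded (B : R) : exists n, B < r n.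
Proof.
have H n : q ^+ n * r 0 <= r n.
  elim: n => [|n IHn]; first by rewrite expr0 mul1r.
  rewrite exprS -mulrA (le_trans _ (r_step n)) // ler_pM2l //.
  exact: lt_trans q_gt1.
have q0 : 0 < q - 1 by rewrite subr_gt0.
have H2 n : n%:R * (q - 1) <= q ^+ n.
  elim: n => [|n IHn]; first by rewrite mul0r expr0.
  have qn : 1 <= q ^+ n by rewrite exprn_ege1 // ltW.
  rewrite exprS -natr1; have -> : q * q ^+ n = q ^+ n + (q - 1) * q ^+ n by ring.
  have : q - 1 <= (q - 1) * q ^+ n by rewrite ler_peMr // ltW.
  lra.
exists (Num.truncn (B / r 0 / (q - 1))).+1.
apply: lt_le_trans (H _); rewrite -ltr_pdivrMr ?r_gt0 //.
apply: lt_le_trans (H2 _); rewrite -ltr_pdivrMr //.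
exact: truncnS_gt.
Qed.

(** The inner edge is the midpoint of two consecutive radii, the larger at least [q] times the
    smaller, and the smaller at least that of [g m]. *)
Lemma OmegaS_ge m n z : (m < n)%N -> Omega g n z -> (1 + q) / 2 * r m <= cabs (toC z).
Proof.
case: n => // n mn [/= h _]; apply: le_trans h.
have := r_step n; have := @r_mono m n mn.
set x := r m; set y := r n; set t := r n.+1 => h1 h2.
have : (1 + q) * x <= (1 + q) * y by rewrite ler_pM2l // addr_gt0 // (lt_trans _ q_gt1).
lra.
Qed.

(** The outer edge is the midpoint of two radii, the smaller at most 1/q times the larger: the
    factor is (1 + 1/q) / 2. *)
Lemma Omega_lt m n z : (n < m)%N -> Omega g n z -> cabs (toC z) < (1 + q) / (2 * q) * r m.
Proof.
move=> nm zn.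
have : cabs (toC z) < (r n + r n.+1) / 2 by case: n zn {nm} => [//|n []].
move=> /lt_le_trans; apply.
have q0 : 0 < q := lt_trans ltr01 q_gt1.
have := r_step n; have := r_mono nm; set x := r n; set y := r n.+1; set t := r m => h1 h2.
have -> : (1 + q) / (2 * q) * t = (1 + q) * t / q / 2.
  by field; rewrite gt_eqF.
rewrite ler_pM2r ?invr_gt0 // ler_pdivlMr //.
have : (1 + q) * y <= (1 + q) * t by rewrite ler_pM2l // addr_gt0.
lra.
Qed.

Lemma Omega_lt_r m n z : (n < m)%N -> Omega g n z -> cabs (toC z) < r m.
Proof.
move=> nm zn; apply: lt_le_trans (Omega_lt nm zn) _.
have q0 : 0 < q := lt_trans ltr01 q_gt1.
rewrite -[leRHS]mul1r ler_pM2r ?r_gt0 // ler_pdivrMr ?mulr_gt0 //.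
by move: q_gt1; lra.
Qed.

Lemma Omega_gt_r m n z : (m < n)%N -> Omega g n z -> r m < cabs (toC z).
Proof.
move=> nm zn; apply: lt_le_trans (OmegaS_ge nm zn).
rewrite ltr_pMl ?r_gt0 // ltr_pdivlMr //.
by move: q_gt1; lra.
Qed.

(** The triangle inequality yields the better constant (q - 1) / (q + 1). It is lowered to the one
    that nodes outside the annulus allow, so that both cases share a single constant. *)
Lemma Omega_off_lt m n z : (m < n)%N -> Omega g n z ->
  (q - 1) / (2 * q) * cabs (toC z) <= cabs (toC z - g m).
Proof.
move=> mn zn; apply: le_trans (lerB_cabs _ _).
have := OmegaS_ge mn zn; move: (cabs (toC z)) (cabs_ge0 (toC z)) => s s0 h.
have q0 : 0 < q := lt_trans ltr01 q_gt1.
have q1 : 0 < 1 + q by rewrite addr_gt0.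
have h' : r m <= 2 / (1 + q) * s.
  have -> : 2 / (1 + q) * s = s / ((1 + q) / 2) by field; rewrite gt_eqF.
  by rewrite ler_pdivlMr ?divr_gt0 // mulrC.
have : 0 <= (1 - (q - 1) / (2 * q) - 2 / (1 + q)) * s.
  apply: mulr_ge0 => //.
  have -> : 1 - (q - 1) / (2 * q) - 2 / (1 + q) = (q - 1) ^+ 2 / (2 * q * (1 + q)).
    by field; rewrite !gt_eqF.
  by rewrite divr_ge0 ?sqr_ge0 // mulr_ge0 ?mulr_ge0 // ltW.
lra.
Qed.

Lemma Omega_off_gt m n z : (n < m)%N -> Omega g n z ->
  (q - 1) / (2 * q) * r m <= cabs (toC z - g m).
Proof.
move=> nm zn; rewrite cabsB; apply: le_trans (lerB_cabs _ _).
have := ltW (Omega_lt nm zn).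
have q0 : 0 < q := lt_trans ltr01 q_gt1.
have -> : (q - 1) / (2 * q) * r m = r m - (1 + q) / (2 * q) * r m.
  by field; rewrite gt_eqF.
by move=> h; rewrite lerD2l lerN2.
Qed.

Lemma Omega_cover : \bigcup_n Omega g n = setT.
Proof.
apply/seteqP; split => // z _.
have ex : exists n, cabs (toC z) < (r n + r n.+1) / 2.
  have [n zn] := r_unbounded (cabs (toC z)); exists n.
  by have := r_ltS n; lra.
(* Take the least index whose outer edge lies beyond z; its minimality is the inner bound. *)
case: (ex_minnP ex) => -[|n] hn hmin; first by exists 0%N.
exists n.+1 => //=; split => //.
by rewrite leNgt; apply/negP => /hmin; rewrite ltnn.
Qed.

Lemma Omega_trivIset : trivIset setT (Omega g).
Proof.
have H m n z : (m < n)%N -> Omega g m z -> Omega g n z -> False.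
  case: n => // n mn zm [/= h _].
  have : cabs (toC z) < (r m + r m.+1) / 2 by case: m zm {mn} => [//|m []].
  have := @r_mono m n mn; have := @r_mono m.+1 n.+1 mn; lra.
apply/trivIsetP => m n _ _ /eqP mn; apply/seteqP; split => // z [zm zn].
by case: (ltngtP m n) => // /H; [apply; eassumption|apply; eassumption].
Qed.

End Annuli.

(** * Measurability of the annuli and of the integrands *)

Section Measurability.
Variable R : realType.

(** Inversion is continuous only away from 0, so the point 0 is split off as a measurable
    singleton. *)
Lemma measurable_invr : measurable_fun [set: R] (@GRing.inv R).
Proof.
have -> : [set: R] = [set 0] `|` ~` [set 0] by rewrite setUv.
apply/measurable_funU => //; first exact: measurableC.
split; first exact: measurable_fun_set1.
apply: open_continuous_measurable_fun.
  by rewrite openC; exact: closed_eq.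
by move=> x /[!inE] /eqP x0; exact: inv_continuous.
Qed.

Lemma measurable_cabs_toC : measurable_fun [set: (R * R)%type] (fun z => cabs (toC z)).
Proof.
rewrite /cabs /toC /=.
apply: (@measurableT_comp _ _ _ _ _ _ (@Num.sqrt R)).
  by apply: continuous_measurable_fun; exact: sqrt_continuous.
by apply: measurable_funD; apply: measurable_funX;
  [exact: measurable_fst|exact: measurable_snd].
Qed.

Lemma measurable_Omega (g : nat -> R[i]) n : measurable (Omega g n).
Proof.
have lt t : measurable [set z : (R * R)%type | cabs (toC z) < t].
  have := measurable_cabs_toC measurableT (measurable_itv `]-oo, t[).
  rewrite setTI; congr measurable; apply/seteqP; split => z /=; rewrite in_itv //=.
have ge t : measurable [set z : (R * R)%type | t <= cabs (toC z)].
  have := measurable_cabs_toC measurableT (measurable_itv `[t, +oo[).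
  rewrite setTI; congr measurable; apply/seteqP; split => z /=; rewrite in_itv //= andbT //.
case: n => [|n] /=; first exact: lt.
exact: measurableI (ge _) (lt _).
Qed.

Lemma measurable_Re_toCB (c : R[i]) :
  measurable_fun [set: (R * R)%type] (fun z => complex.Re (toC z - c)).
Proof.
case: c => a b; rewrite /toC /=; apply: measurable_funB => //.
Qed.

Lemma measurable_Im_toCB (c : R[i]) :
  measurable_fun [set: (R * R)%type] (fun z => complex.Im (toC z - c)).
Proof.
case: c => a b; rewrite /toC /=; apply: measurable_funB => //.
Qed.

Lemma measurable_invsqr_toCB (c : R[i]) :
  measurable_fun [set: (R * R)%type] (fun z => (cabs (toC z - c) ^+ 2)^-1).
Proof.
under eq_fun do rewrite sqr_cabs.
apply: (@measurableT_comp _ _ _ _ _ _ (@GRing.inv R)).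
  exact: measurable_invr.
by apply: measurable_funD; apply: measurable_funX;
  [exact: measurable_Re_toCB|exact: measurable_Im_toCB].
Qed.

Lemma measurable_invsqr_toC :
  measurable_fun [set: (R * R)%type] (fun z => (cabs (toC z) ^+ 2)^-1).
Proof. by have := measurable_invsqr_toCB 0; under eq_fun do rewrite subr0. Qed.

Variables (g : nat -> R[i]) (v : nat -> R) (a : nat -> R[i]).

Lemma measurable_Re_Hterm n :
  measurable_fun [set: (R * R)%type] (fun z => complex.Re (Hterm g v a z n)).
Proof.
under eq_fun do rewrite Re_div -sqr_cabs.
apply: measurable_funM; last exact: measurable_invsqr_toCB.
by apply: measurable_funD; apply: measurable_funM => //;
  [exact: measurable_Re_toCB|exact: measurable_Im_toCB].
Qed.

Lemma measurable_Im_Hterm n :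
  measurable_fun [set: (R * R)%type] (fun z => complex.Im (Hterm g v a z n)).
Proof.
under eq_fun do rewrite Im_div -sqr_cabs.
apply: measurable_funM; last exact: measurable_invsqr_toCB.
by apply: measurable_funB; apply: measurable_funM => //;
  [exact: measurable_Re_toCB|exact: measurable_Im_toCB].
Qed.

Lemma measurable_sqr_Hsum N : measurable_fun [set: (R * R)%type]
  (fun z => cabs (\sum_(0 <= n < N) Hterm g v a z n) ^+ 2).
Proof.
under eq_fun do rewrite sqr_cabs Re_sum Im_sum.
by apply: measurable_funD; apply: measurable_funX; apply: measurable_sum => n;
  [exact: measurable_Re_Hterm|exact: measurable_Im_Hterm].
Qed.

End Measurability.

(** * Necessity *)

Section NonnegSeries.
Variable R : realType.
Local Open Scope ereal_scope.

Lemma nneseries_le (f : nat -> \bar R) m (B : \bar R) :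
  (forall n, 0 <= f n) -> (forall K, \sum_(m <= n < K) f n <= B) ->
  \sum_(m <= n <oo) f n <= B.
Proof.
move=> f0 fB; apply: lime_le; first by apply: is_cvg_nneseries.
by near=> K; exact: fB.
Unshelve. all: by end_near. Qed.

Lemma nneseries_tail_le (f : nat -> \bar R) m : (forall n, 0 <= f n) ->
  \sum_(m <= n <oo) f n <= \sum_(0 <= n <oo) f n.
Proof.
move=> f0; apply: nneseries_le => // K; apply: le_trans (nneseries_lim_ge K _) => //.
have [mK|Km] := leqP m K; last by rewrite big_geq ?sume_ge0 // ltnW.
by rewrite [leRHS](@big_cat_nat _ _ _ m) //= leeDr ?sume_ge0.
Qed.

Lemma nneseries_fin (f : nat -> R) N : (forall n, (N <= n)%N -> f n = 0%R) ->
  \sum_(0 <= n <oo) (f n)%:E = (\sum_(0 <= n < N) f n)%R%:E.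
Proof.
move=> f0; apply: lim_near_cst => //.
near=> K; have NK : (N <= K)%N by near: K; exact: nbhs_infty_ge.
rewrite sumEFin (@big_cat_nat _ _ _ N) //= [X in (_ + X)%R]big1_seq ?addr0 //.
by move=> i /= /[!mem_index_iota] /andP[/f0].
Unshelve. all: by end_near. Qed.

End NonnegSeries.

(** * Partial sums and finitely supported sequences *)

Section Hsum.
Variables (R : realType) (g : nat -> R[i]) (v : nat -> R).
Implicit Types (a : nat -> R[i]) (z : (R * R)%type).

Definition Hsum a z N : R[i] := \sum_(0 <= n < N) Hterm g v a z n.

(** Both limits in [Hop] are of eventually constant sequences, so finitely supported test sequences
    raise no question of convergence. *)
Lemma Hop_fin a z N : (forall n, (N <= n)%N -> a n = 0) -> Hop g v a z = Hsum a z N.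
Proof.
move=> a0.
have h K : (N <= K)%N -> Hsum a z K = Hsum a z N.
  move=> NK; rewrite /Hsum (@big_cat_nat _ _ _ N) //= [X in _ + X]big1_seq ?addr0 //.
  by move=> i /= /[!mem_index_iota] /andP[/a0 ai _]; rewrite /Hterm ai !mul0r.
rewrite /Hop; have -> : limn (fun K => \sum_(0 <= n < K) complex.Re (Hterm g v a z n)) =
    complex.Re (Hsum a z N).
  apply: lim_near_cst => //; near=> K; rewrite -Re_sum -/(Hsum a z K) h //.
  by near: K; exact: nbhs_infty_ge.
have -> : limn (fun K => \sum_(0 <= n < K) complex.Im (Hterm g v a z n)) =
    complex.Im (Hsum a z N).
  apply: lim_near_cst => //; near=> K; rewrite -Im_sum -/(Hsum a z K) h //.
  by near: K; exact: nbhs_infty_ge.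
by case: (Hsum a z N).
Unshelve. all: by end_near. Qed.

Lemma ell2v_norm2_fin a N : (forall n, (N <= n)%N -> a n = 0) ->
  ell2v_norm2 v a = (\sum_(0 <= n < N) cabs (a n) ^+ 2 * v n)%:E.
Proof.
move=> a0; rewrite /ell2v_norm2; apply: (@nneseries_fin _ (fun n => cabs (a n) ^+ 2 * v n)).
by move=> n /a0 ->; rewrite cabs0 expr0n mul0r.
Qed.

End Hsum.

(** * Splitting an integral along the annuli *)

Section Integrals.
Variables (R : realType) (mu : {measure set (R * R)%type -> \bar R}).
Variables (g : nat -> R[i]) (q : R).
Hypotheses (g_neq0 : forall n, g n != 0) (q_gt1 : 1 < q).
Hypothesis g_sparse : forall n, q <= cabs (g n.+1) / cabs (g n).
Local Open Scope ereal_scope.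

Lemma integral_Omega (f : R * R -> \bar R) : measurable_fun setT f ->
  (forall z, 0 <= f z) ->
  \int[mu]_z f z = \sum_(0 <= n <oo) \int[mu]_(z in Omega g n) f z.
Proof.
move=> mf f0; rewrite -(Omega_cover g_neq0 q_gt1 g_sparse).
rewrite ge0_integral_bigcup //.
- by move=> n; exact: measurable_Omega.
- by rewrite (Omega_cover g_neq0 q_gt1 g_sparse).
- exact: Omega_trivIset g_neq0 q_gt1 g_sparse.
Qed.

Lemma Omega_integral_ge0 (f : R * R -> R) n : (forall z, (0 <= f z)%R) ->
  0 <= \int[mu]_(z in Omega g n) (f z)%:E.
Proof. by move=> f0; apply: integral_ge0 => z _; rewrite lee_fin. Qed.

End Integrals.

(** * Test sequences *)

Section Necessity.
Variables (R : realType) (mu : {measure set (R * R)%type -> \bar R}).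
Variables (g : nat -> R[i]) (v : nat -> R) (q : R) (C : R).
Hypotheses (g_neq0 : forall n, g n != 0) (q_gt1 : 1 < q).
Hypothesis g_sparse : forall n, q <= cabs (g n.+1) / cabs (g n).
Hypothesis v_pos : forall n, 0 < v n.
Hypothesis HC : forall a : nat -> R[i], (ell2v_norm2 v a < +oo)%E ->
  (\int[mu]_z ((cabs (Hop g v a z)) ^+ 2)%:E <= C%:E * ell2v_norm2 v a)%E.

(** The integral is cut along the annuli so that each test can discard those on which it has no
    lower bound. *)
Lemma Hsum_bounded a N : (forall n, (N <= n)%N -> a n = 0) ->
  (\sum_(0 <= m <oo) \int[mu]_(z in Omega g m) (cabs (Hsum g v a z N) ^+ 2)%:E
    <= (C * \sum_(0 <= n < N) cabs (a n) ^+ 2 * v n)%:E)%E.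
Proof.
move=> a0; have := @HC a; rewrite (ell2v_norm2_fin v a0) ltry => /(_ isT).
rewrite -EFinM; apply: le_trans.
rewrite -(integral_Omega mu g_neq0 q_gt1 g_sparse).
- by under [leRHS]eq_integral do rewrite (Hop_fin g v _ a0).
- by apply/measurable_EFinP; exact: measurable_sqr_Hsum.
- by move=> z; rewrite lee_fin sqr_ge0.
Qed.

Lemma diagonal_necessary n :
  (\int[mu]_(z in Omega g n) (v n / cabs (toC z - g n) ^+ 2)%:E <= C%:E)%E.
Proof.
pose a k : R[i] := if k == n then 1 else 0.
have a0 k : (n.+1 <= k)%N -> a k = 0 by move=> nk; rewrite /a gtn_eqF.
(* Stated for any [nmodType], since it collapses both the real sum in the norm and the complex sum
   in the transform. *)
have sums (V : nmodType) (F : nat -> V) : (forall k, k != n -> F k = 0) ->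
    \sum_(0 <= k < n.+1) F k = F n.
  move=> F0; rewrite big_nat_recr //= big1_seq ?add0r // => k /=.
  by rewrite mem_index_iota => /andP[_ kn]; rewrite F0 // ltn_eqF.
have := Hsum_bounded a0; rewrite sums; last first.
  by move=> k /negbTE kn; rewrite /a kn cabs0 expr0n mul0r.
rewrite {2}/a eqxx cabs1 expr1n mul1r => H.
have {}H := le_trans (nneseries_lim_ge n.+1 _) H.
have fge0 k : (0 <= \int[mu]_(z in Omega g k) (cabs (Hsum g v a z n.+1) ^+ 2)%:E)%E.
  by apply: Omega_integral_ge0 => z; exact: sqr_ge0.
have {}H := H (fun k _ _ => fge0 k).
rewrite big_nat_recr //= in H.
have {}H := le_trans (leeDr _ (sume_ge0 _ _)) H.
have {H} := H (fun k _ => fge0 k).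
(* The squared norm of the basis vector is [v n]; the same factor comes out of the integral and
   cancels. *)
rewrite (_ : (\int[mu]_(z in Omega g n) (cabs (Hsum g v a z n.+1) ^+ 2)%:E)%E =
   ((v n)%:E * \int[mu]_(z in Omega g n) (v n / cabs (toC z - g n) ^+ 2)%:E)%E).
  by rewrite [(C * _)%R]mulrC EFinM lee_pmul2l ?lte_fin // fin_numE.
rewrite -ge0_integralZl_EFin //; last first.
- exact: ltW.
- apply/measurable_EFinP; apply: measurable_funM => //.
  by apply: measurable_funTS; exact: measurable_invsqr_toCB.
- by move=> z _; rewrite lee_fin divr_ge0 ?sqr_ge0 // ltW.
- exact: measurable_Omega.
apply: eq_integral => z _; rewrite -EFinM /Hsum sums; last first.
  by move=> k /negbTE kn; rewrite /Hterm /a kn !mul0r.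
rewrite /Hterm /a eqxx mul1r cabsM cabsV cabs_real ger0_norm ?(ltW (v_pos _)) //.
by rewrite exprMn exprVn expr2 -mulrA.
Qed.

Lemma lower_necessary n :
  ((\sum_(l < n.+1) (v l)%:E) *
    (\sum_(n.+1 <= m <oo) \int[mu]_(z in Omega g m) (cabs (toC z) ^+ 2)^-1%:E)
      <= (4 * C)%:E)%E.
Proof.
pose a k : R[i] := if (k < n.+1)%N then 1 else 0.
have a0 k : (n.+1 <= k)%N -> a k = 0 by move=> nk; rewrite /a ltnNge nk.
pose V := \sum_(0 <= l < n.+1) v l.
have V0 : 0 < V by exact: psum_gt0.
have := Hsum_bounded a0.
have -> : \sum_(0 <= k < n.+1) cabs (a k) ^+ 2 * v k = V.
  apply: eq_big_nat => k /andP[_ kn].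
  by rewrite /a kn cabs1 expr1n mul1r.
have fge0 k : (0 <= \int[mu]_(z in Omega g k) (cabs (Hsum g v a z n.+1) ^+ 2)%:E)%E.
  by apply: Omega_integral_ge0 => z; exact: sqr_ge0.
move=> /(le_trans (nneseries_tail_le n.+1 fge0)) H.
have wge0 k : (0 <= \int[mu]_(z in Omega g k) (cabs (toC z) ^+ 2)^-1%:E)%E.
  by apply: Omega_integral_ge0 => z; rewrite invr_ge0 sqr_ge0.
have -> : (\sum_(l < n.+1) (v l)%:E = V%:E)%E.
  by rewrite -(big_mkord xpredT (fun l => (v l)%:E)) sumEFin.
(* The test sequence has squared norm [V], and its transform is at least V / (2 |z|) in modulus.
   Multiplying the goal by V / 4 turns it into (V / 2)^2 times the tail against C V. *)
have V4 : 0 < V / 4 by rewrite divr_gt0.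
rewrite -(@lee_pmul2l _ (V / 4)%:E) // ?lte_fin // muleA -!EFinM.
have -> : V / 4 * (4 * C) = C * V by field.
apply: le_trans H.
rewrite -nneseriesZl //.
rewrite eseries_cond [leRHS]eseries_cond; apply: lee_nneseries.
  by move=> k _ _; rewrite mule_ge0 // lee_fin mulr_ge0 ?ltW.
move=> m /= nm.
rewrite -ge0_integralZl_EFin //; last first.
- by rewrite mulr_ge0 ?ltW.
- by apply/measurable_EFinP/measurable_funTS; exact: measurable_invsqr_toC.
- by move=> z _; rewrite lee_fin invr_ge0 sqr_ge0.
- exact: measurable_Omega.
apply: ge0_le_integral => //.
- exact: measurable_Omega.
- by move=> z _; rewrite lee_fin mulr_ge0 ?invr_ge0 ?sqr_ge0 ?mulr_ge0 ?ltW.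
- apply/measurable_EFinP/measurable_funTS; apply: measurable_funM => //.
  exact: measurable_invsqr_toC.
- by apply/measurable_EFinP/measurable_funTS; exact: measurable_sqr_Hsum.
move=> z zm; rewrite lee_fin.
have zg k : (k < n.+1)%N -> cabs (g k) < cabs (toC z).
  by move=> kn; apply: (Omega_gt_r g_neq0 q_gt1 g_sparse _ zm); exact: leq_trans nm.
have z0 : 0 < cabs (toC z) by apply: le_lt_trans (zg 0%N _) => //; exact: cabs_ge0.
rewrite ler_pdivrMr ?exprn_gt0 // -exprMn -cabsM.
have -> : V / 4 * V = (V / 2) ^+ 2 by field.
rewrite ler_sqr ?nnegrE ?cabs_ge0 ?divr_ge0 ?(ltW V0) //.
(* Multiplied by z, the transform is a sum of v_k z / (z - g_k), whose real parts are at least v_k /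
   2 because z lies farther out than every g_k. *)
apply: le_trans (ler_Re_cabs _).
rewrite [Hsum _ _ _ _ _ * _]mulrC /Hsum mulr_sumr Re_sum /V mulr_suml.
apply: ler_sum_nat => k /andP[_ kn].
rewrite /Hterm /a kn mul1r mulrCA mulrA -mulrA ReZ ler_pM2l //.
rewrite -[2^-1]mul1r Re_div_ge_half ?(ltW (zg _ _)) //.
by apply/eqP => zk; have := zg _ kn; rewrite zk ltxx.
Qed.

(** The test sequence is cut at [L] to have finite support. Its squared norm is [U L], its transform
    is at least U L / 2 in modulus on the first annuli, and the bound 4 C is uniform in [L]. *)
Lemma upper_necessary n :
  ((\sum_(m < n.+1) mu (Omega g m)) *
     (\sum_(n.+1 <= l <oo) (v l / cabs (g l) ^+ 2)%:E) <= (4 * C)%:E)%E.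
Proof.
pose U L := \sum_(n.+1 <= l < L) v l / cabs (g l) ^+ 2.
have u0 l : 0 < v l / cabs (g l) ^+ 2 by rewrite divr_gt0 // exprn_gt0 // cabs_gt0.
have U0 L : (n.+1 < L)%N -> 0 < U L.
  move=> nL; rewrite /U big_ltn // ltr_pwDl //.
  by apply: sumr_ge0 => i _; exact: ltW.
pose S := (\sum_(m < n.+1) mu (Omega g m))%E.
have S0 : (0 <= S)%E by apply: sume_ge0.
have SU L : (n.+1 < L)%N -> (S * (U L)%:E <= (4 * C)%:E)%E.
  (* With this coefficient the k-th term of the transform is v_k / |g_k|^2 times g_k / (g_k - z). *)
  move=> nL; pose a k : R[i] :=
    if (n < k < L)%N then - g k * ((cabs (g k) ^- 2)%:C)%C else 0.
  have a0 k : (L <= k)%N -> a k = 0.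
    by move=> Lk; rewrite /a [(k < L)%N]ltnNge Lk andbF.
  have ak k : (n < k < L)%N -> a k = - g k * ((cabs (g k) ^- 2)%:C)%C.
    by rewrite /a => ->.
  have ak0 k : (k < n.+1)%N -> a k = 0 by rewrite /a ltnS leqNgt => /negbTE ->.
  have := Hsum_bounded a0.
  have -> : \sum_(0 <= k < L) cabs (a k) ^+ 2 * v k = U L.
    rewrite (@big_cat_nat _ _ _ n.+1) //=; last exact: ltnW.
    rewrite big1_seq ?add0r.
      apply: eq_big_nat => k /ak ->.
      rewrite cabsM cabsN cabs_real ger0_norm ?invr_ge0 ?sqr_ge0 //.
      by have := r_gt0 g_neq0 k; move: (cabs _) (v k) => c w /lt0r_neq0 c0; field.
    move=> k /= /[!mem_index_iota] /andP[_ /ak0 ->].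
    by rewrite cabs0 expr0n mul0r.
  have fge0 k : (0 <= \int[mu]_(z in Omega g k) (cabs (Hsum g v a z L) ^+ 2)%:E)%E.
    by apply: Omega_integral_ge0 => z; exact: sqr_ge0.
  move=> /(le_trans (nneseries_lim_ge n.+1 (fun k _ _ => fge0 k))) H.
  have UL := U0 _ nL.
  have U4 : 0 < U L / 4 by rewrite divr_gt0.
  rewrite -(@lee_pmul2l _ (U L / 4)%:E) // ?lte_fin // -EFinM.
  have -> : U L / 4 * (4 * C) = C * U L by field.
  apply: le_trans H.
  rewrite muleCA -EFinM.
  have -> : U L / 4 * U L = (U L / 2) ^+ 2 by field.
  rewrite muleC ge0_sume_distrr // -(big_mkord xpredT (fun m => _ * mu (Omega g m))%E).
  rewrite big_nat [leRHS]big_nat; apply: lee_sum => m /= mn.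
  rewrite -(integral_cst mu (measurable_Omega g m)) /cst.
  apply: ge0_le_integral => //.
  - exact: measurable_Omega.
  - by move=> z _; rewrite lee_fin sqr_ge0.
  - by apply/measurable_EFinP/measurable_funTS; exact: measurable_sqr_Hsum.
  move=> z zm; rewrite lee_fin.
  rewrite ler_sqr ?nnegrE ?cabs_ge0 ?divr_ge0 ?(ltW UL) //.
  apply: le_trans (ler_Re_cabs _).
  rewrite /Hsum (@big_cat_nat _ _ _ n.+1) //=; last exact: ltnW.
  rewrite big1_seq ?add0r; last first.
    by move=> k /= /[!mem_index_iota] /andP[_ /ak0 ak1]; rewrite /Hterm ak1 !mul0r.
  rewrite Re_sum /U mulr_suml; apply: ler_sum_nat => k nkL.
  have zg : cabs (toC z) < cabs (g k).
    apply: (Omega_lt_r g_neq0 q_gt1 g_sparse _ zm).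
    by case/andP: nkL => nk _; exact: leq_trans mn nk.
  have -> : Hterm g v a z k = ((v k / cabs (g k) ^+ 2)%:C)%C * (g k / (g k - toC z)).
    rewrite /Hterm ak // -[g k - toC z]opprB invrN rmorphM /=; ring.
  rewrite ReZ ler_pM2l // -[2^-1]mul1r Re_div_ge_half ?(ltW zg) //.
  by apply/eqP => zk; move: zg; rewrite -zk ltxx.
(* The one-term tail is positive, so its bounded product with [S] forces [S] to be finite; only then
   can [S] enter the series as a real factor. *)
have Sfin : S \is a fin_num.
  rewrite ge0_fin_numE // ltey; apply/eqP => Soo.
  have := SU n.+2 (ltnSn _); rewrite Soo gt0_mulye ?lte_fin ?U0 //.
rewrite -/S -(fineK Sfin) -nneseriesZl; last by move=> i _; rewrite lee_fin ltW.
apply: nneseries_le => [l|L].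
  by rewrite mule_ge0 // lee_fin ?fine_ge0 // ltW.
rewrite -ge0_sume_distrr; last by move=> i _; rewrite lee_fin ltW.
rewrite (fineK Sfin) sumEFin.
have [nL|Ln] := ltnP n.+1 L; first exact: SU.
(* For an empty tail the claim is 0 <= 4 C, which follows from a nonempty one. *)
rewrite big_geq // mule0; apply: le_trans (SU n.+2 (ltnSn _)).
by rewrite mule_ge0 // lee_fin ltW // U0.
Qed.

End Necessity.

(** * Sufficiency *)

Section Pointwise.
Variables (R : realType) (g : nat -> R[i]) (v : nat -> R) (q : R).
Hypotheses (g_neq0 : forall n, g n != 0) (q_gt1 : 1 < q).
Hypothesis g_sparse : forall n, q <= cabs (g n.+1) / cabs (g n).
Hypothesis v_pos : forall n, 0 < v n.
Implicit Types (a : nat -> R[i]) (z : (R * R)%type).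

Local Notation c := ((q - 1) / (2 * q)).
Local Notation r n := (cabs (g n)).
Local Notation u n := (v n / r n ^+ 2).

Lemma sep_gt0 : 0 < c.
Proof. by rewrite divr_gt0 ?subr_gt0 // mulr_gt0 // (lt_trans ltr01). Qed.

Lemma cabs_Hterm a z n : cabs (Hterm g v a z n) = cabs (a n) * v n / cabs (toC z - g n).
Proof. by rewrite /Hterm !cabsM cabsV cabs_real ger0_norm // ltW. Qed.

Lemma cabs_Hterm_le_inner a z m n : (m < n)%N -> Omega g n z ->
  cabs (Hterm g v a z m) <= c^-1 * (cabs (toC z))^-1 * (cabs (a m) * v m).
Proof.
move=> mn zn; rewrite cabs_Hterm mulrC.
apply: ler_wpM2r; first by rewrite mulr_ge0 ?cabs_ge0 ?ltW.
have z0 : 0 < cabs (toC z).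
  by apply: le_lt_trans (Omega_gt_r g_neq0 q_gt1 g_sparse mn zn); exact: cabs_ge0.
have h := Omega_off_lt g_neq0 q_gt1 g_sparse mn zn.
have p : 0 < c * cabs (toC z) by rewrite mulr_gt0 // sep_gt0.
by rewrite -invfM lef_pV2 // posrE //; exact: lt_le_trans h.
Qed.

(** The bound |a| v / r is written as (|a| r) u with u = v / r^2: then (|a| r)^2 u = |a|^2 v, so the
    dual Hardy inequality for the weight u returns the original norm. *)
Lemma cabs_Hterm_le_outer a z m n : (n < m)%N -> Omega g n z ->
  cabs (Hterm g v a z m) <= c^-1 * (cabs (a m) * r m * u m).
Proof.
move=> nm zn; rewrite cabs_Hterm.
have -> : c^-1 * (cabs (a m) * r m * u m) = cabs (a m) * v m * (c * r m)^-1.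
  have /lt0r_neq0 := r_gt0 g_neq0 m; have /lt0r_neq0 := sep_gt0.
  by move: c (r m) (v m) => d x y d0 x0; field; rewrite d0 x0.
apply: ler_wpM2l; first by rewrite mulr_ge0 ?cabs_ge0 ?ltW.
have h := Omega_off_gt g_neq0 q_gt1 g_sparse nm zn.
have p : 0 < c * r m by rewrite mulr_gt0 ?sep_gt0 // cabs_gt0.
by rewrite lef_pV2 // posrE //; exact: lt_le_trans h.
Qed.

Lemma cabs_Hsum_le a z n K : (n < K)%N -> Omega g n z ->
  cabs (Hsum g v a z K) <=
    c^-1 * (cabs (toC z))^-1 * \sum_(0 <= l < n) cabs (a l) * v l
    + cabs (a n) * v n / cabs (toC z - g n)
    + c^-1 * \sum_(n.+1 <= l < K) cabs (a l) * r l * u l.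
Proof.
move=> nK zn; apply: le_trans (ler_cabs_sum _ _ _) _.
rewrite (@big_cat_nat _ _ _ n) //=; last exact: ltnW.
rewrite [X in _ + X]big_ltn // addrA; apply: lerD; last first.
  rewrite mulr_sumr; apply: ler_sum_nat => l /andP[nl _].
  exact: cabs_Hterm_le_outer nl zn.
apply: lerD; last by rewrite cabs_Hterm.
rewrite mulr_sumr; apply: ler_sum_nat => l /andP[_ ln].
exact: cabs_Hterm_le_inner ln zn.
Qed.

(** The 3 is that of (x + y + w)^2 <= 3 (x^2 + y^2 + w^2). Only the two inverse squares still depend
    on z, and the hypotheses bound their integrals. *)
Lemma sqr_Hsum_le a z n K : (n < K)%N -> Omega g n z ->
  cabs (Hsum g v a z K) ^+ 2 <=
    3 * c ^- 2 * (\sum_(0 <= l < n) cabs (a l) * v l) ^+ 2 * (cabs (toC z) ^+ 2)^-1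
    + 3 * (cabs (a n) ^+ 2 * v n) * (v n / cabs (toC z - g n) ^+ 2)
    + 3 * c ^- 2 * (\sum_(n.+1 <= l < K) cabs (a l) * r l * u l) ^+ 2.
Proof.
move=> nK zn; have := cabs_Hsum_le a nK zn.
have : 0 <= cabs (Hsum g v a z K) by exact: cabs_ge0.
set X := cabs (Hsum _ _ _ _ _).
set A := \sum_(0 <= _ < _) _; set B := \sum_(_ <= _ < _) _.
rewrite -!exprVn; move: X c^-1 (cabs (toC z))^-1 (cabs (toC z - g n))^-1.
move=> X d s t X0.
set x := d * s * A; set y := cabs (a n) * v n * t; set w := d * B => h.
have : X ^+ 2 <= (x + y + w) ^+ 2.
  by rewrite ler_sqr ?nnegrE // (le_trans X0).
move=> /le_trans; apply.
rewrite -subr_ge0 [X in 0 <= X](_ : _ = (x - y) ^+ 2 + (y - w) ^+ 2 + (x - w) ^+ 2).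
  by rewrite !addr_ge0 ?sqr_ge0.
by rewrite /x /y /w; ring.
Qed.

(* [cabs (a l) / r l <= (cabs (a l) ^+ 2 + r l ^- 2) / 2] reduces convergence to
   the finiteness of the norm of [a] and of the sum of the [u l]. *)
Lemma is_cvg_Hterm a z S T :
  (forall N, \sum_(0 <= l < N) cabs (a l) ^+ 2 * v l <= S) ->
  (forall N, \sum_(0 <= l < N) u l <= T) ->
  forall F : R[i] -> R, (forall x, `|F x| <= cabs x) ->
  cvgn (fun N => \sum_(0 <= l < N) F (Hterm g v a z l)).
Proof.
move=> hS hT F hF.
have [n _ zn] : (\bigcup_n Omega g n) z by rewrite (Omega_cover g_neq0 q_gt1 g_sparse).
apply: (@normed_cvg R R^o (fun l => F (Hterm g v a z l))).
apply: nondecreasing_is_cvgn.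
  by apply/nondecreasing_seqP => k; rewrite /= /series /= (big_nat_recr k) //= lerDl.
pose f l := cabs (Hterm g v a z l).
(* Terms up to the annulus of z, among them a possible pole, are kept as a finite sum; beyond [n]
   the outer bound applies. *)
exists (\sum_(0 <= l < n.+1) f l + c^-1 * (S + T)) => _ [N _ <-].
rewrite /series /=; apply: le_trans (ler_sum _ (fun l _ => hF _)) _.
have c0 : 0 <= c^-1 by rewrite invr_ge0 ltW // sep_gt0.
apply: (@le_trans _ _ (\sum_(0 <= l < n.+1) f l +
    c^-1 * \sum_(0 <= l < N) (cabs (a l) ^+ 2 * v l + u l))); last first.
  by rewrite lerD2l ler_wpM2l // big_split lerD.
have f0 l : 0 <= f l by exact: cabs_ge0.
have h0 l : 0 <= cabs (a l) ^+ 2 * v l + u l.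
  have vl := ltW (v_pos l).
  by rewrite addr_ge0 // mulr_ge0 // ?invr_ge0 sqr_ge0.
have [Nn|nN] := leqP N n.+1.
  rewrite [X in _ <= X + _](@big_cat_nat _ _ _ N) //= -addrA lerDl.
  by rewrite addr_ge0 ?mulr_ge0 ?sumr_ge0.
rewrite (@big_cat_nat _ _ _ n.+1) //=; last exact: ltnW.
rewrite lerD2l [X in c^-1 * X](@big_cat_nat _ _ _ n.+1) //=; last exact: ltnW.
rewrite mulrDr [X in _ <= X + _]mulr_sumr.
apply: (@le_trans _ _ (c^-1 * \sum_(n.+1 <= l < N) (cabs (a l) ^+ 2 * v l + u l))).
  rewrite mulr_sumr; apply: ler_sum_nat => l /andP[nl _].
  apply: le_trans (cabs_Hterm_le_outer _ nl zn) _; rewrite ler_wpM2l //.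
  have /lt0r_neq0 r0 := r_gt0 g_neq0 l.
  have := ltW (v_pos l); move: (cabs (a l)) (r l) (v l) r0 => x y w y0 w0.
  rewrite -subr_ge0 [X in 0 <= X](_ : _ = w / 2 * ((x - y^-1) ^+ 2 + x ^+ 2 + (y^-1) ^+ 2)).
    by rewrite mulr_ge0 ?divr_ge0 // !addr_ge0 ?sqr_ge0.
  by field.
by rewrite lerDr sumr_ge0 // => l _; rewrite mulr_ge0.
Qed.

End Pointwise.

(** * Integrated bounds and passage to the limit *)

Section Sufficiency.
Variables (R : realType) (mu : {measure set (R * R)%type -> \bar R}).
Variables (g : nat -> R[i]) (v : nat -> R) (q : R).
Hypotheses (g_neq0 : forall n, g n != 0) (q_gt1 : 1 < q).
Hypothesis g_sparse : forall n, q <= cabs (g n.+1) / cabs (g n).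
Hypothesis v_pos : forall n, 0 < v n.
Variables (M1 M2 T : R) (w m : nat -> R).
Local Notation c := ((q - 1) / (2 * q)).
Local Notation r n := (cabs (g n)).
Local Notation u n := (v n / r n ^+ 2).
Hypotheses (M1_ge0 : 0 <= M1) (M2_ge0 : 0 <= M2).
Hypotheses (w_ge0 : forall n, 0 <= w n) (m_ge0 : forall n, 0 <= m n).
Hypothesis hD : forall n,
  (\int[mu]_(z in Omega g n) (v n / cabs (toC z - g n) ^+ 2)%:E <= M1%:E)%E.
(** The first annulus contains the origin, where the inverse square may fail to be integrable; [w 0]
    only ever multiplies an empty sum. *)
Hypothesis hw : forall n,
  (\int[mu]_(z in Omega g n.+1) (cabs (toC z) ^+ 2)^-1%:E <= (w n.+1)%:E)%E.
Hypothesis hm : forall n, (mu (Omega g n) <= (m n)%:E)%E.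
Hypothesis hV : forall n K,
  (\sum_(0 <= l < n.+1) v l) * (\sum_(n.+1 <= k < K) w k) <= M2.
Hypothesis hU : forall n K,
  (\sum_(0 <= k < n.+1) m k) * (\sum_(n.+1 <= l < K) u l) <= M2.
Hypothesis hT : forall N, \sum_(0 <= l < N) u l <= T.

(** The 3 comes from squaring three terms, and 8 M2 from two Hardy inequalities of constant 4 M2. *)
Let B := 3 * (8 * M2 * c ^- 2 + M1).

Lemma u_gt0 n : 0 < u n.
Proof. by rewrite divr_gt0 // exprn_gt0 // cabs_gt0. Qed.

Lemma integral_Omega_Hsum_le a n K : (n < K)%N ->
  (\int[mu]_(z in Omega g n) (cabs (Hsum g v a z K) ^+ 2)%:E <=
   (3 * c ^- 2 * (w n * (\sum_(0 <= l < n) cabs (a l) * v l) ^+ 2)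
    + 3 * M1 * (cabs (a n) ^+ 2 * v n)
    + 3 * c ^- 2 * (m n * (\sum_(n.+1 <= l < K) cabs (a l) * r l * u l) ^+ 2))%:E)%E.
Proof.
move=> nK.
have mO := measurable_Omega g n.
set A := \sum_(0 <= _ < _) _; set D := \sum_(_ <= _ < _) _.
have c2 : 0 <= 3 * c ^- 2 by rewrite mulr_ge0 // invr_ge0 sqr_ge0.
set k1 := 3 * c ^- 2 * A ^+ 2; set k2 := 3 * (cabs (a n) ^+ 2 * v n).
set k3 := 3 * c ^- 2 * D ^+ 2.
have k10 : 0 <= k1 by rewrite mulr_ge0 // sqr_ge0.
have k20 : 0 <= k2 by rewrite mulr_ge0 // mulr_ge0 ?sqr_ge0 ?ltW.
have k30 : 0 <= k3 by rewrite mulr_ge0 // sqr_ge0.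
pose f1 (z : R * R) := (cabs (toC z) ^+ 2)^-1.
pose f2 (z : R * R) := v n / cabs (toC z - g n) ^+ 2.
have f10 z : 0 <= f1 z by rewrite invr_ge0 sqr_ge0.
have f20 z : 0 <= f2 z by rewrite divr_ge0 ?sqr_ge0 ?ltW.
have mf1 : measurable_fun (Omega g n) f1.
  by apply: measurable_funTS; exact: measurable_invsqr_toC.
have mf2 : measurable_fun (Omega g n) f2.
  apply: measurable_funTS; apply: measurable_funM => //.
  exact: measurable_invsqr_toCB.
have mk (k : R) (f : R * R -> R) : measurable_fun (Omega g n) f ->
    measurable_fun (Omega g n) (fun z => (k%:E * (f z)%:E)%E).
  by move=> mf; apply/measurable_EFinP; exact: measurable_funM.
apply: (@le_trans _ _ (\int[mu]_(z in Omega g n)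
    (k1%:E * (f1 z)%:E + k2%:E * (f2 z)%:E + k3%:E)))%E.
  apply: ge0_le_integral => //.
  - by move=> z _; rewrite lee_fin sqr_ge0.
  - by apply/measurable_EFinP/measurable_funTS; exact: measurable_sqr_Hsum.
  - apply: emeasurable_funD; last exact: measurable_cst.
    by apply: emeasurable_funD; exact: mk.
  by move=> z zn; rewrite -!EFinM -!EFinD lee_fin; exact: sqr_Hsum_le zn.
rewrite ge0_integralD //; last 2 first.
- by move=> z _; apply: adde_ge0; apply: mule_ge0; rewrite lee_fin.
- by apply: emeasurable_funD; exact: mk.
rewrite ge0_integralD //; last 4 first.
- by move=> z _; rewrite -!EFinM lee_fin mulr_ge0.
- exact: mk.
- by move=> z _; rewrite -!EFinM lee_fin mulr_ge0.
- exact: mk.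
rewrite !ge0_integralZl_EFin //; last 4 first.
- by move=> z _; rewrite lee_fin.
- exact/measurable_EFinP.
- by move=> z _; rewrite lee_fin.
- exact/measurable_EFinP.
rewrite (integral_cst mu mO) !EFinD; apply: leeD; first apply: leeD.
- have -> : 3 * c ^- 2 * (w n * A ^+ 2) = k1 * w n by rewrite /k1; ring.
  (* On the first annulus no node lies inside, so the inner coefficient vanishes. *)
  have [n0|n0] := posnP n.
    by rewrite (_ : k1 = 0) ?mul0e ?mul0r // /k1 /A n0 big_nil expr0n mulr0.
  by rewrite [leRHS]EFinM; apply: lee_wpmul2l; rewrite ?lee_fin //; have := hw n.-1; rewrite prednK.
- have -> : 3 * M1 * (cabs (a n) ^+ 2 * v n) = k2 * M1 by rewrite /k2; ring.
  by rewrite [leRHS]EFinM; apply: lee_wpmul2l; [rewrite lee_fin|exact: hD].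
- have -> : 3 * c ^- 2 * (m n * D ^+ 2) = k3 * m n by rewrite /k3; ring.
  by rewrite [leRHS]EFinM; apply: lee_wpmul2l; [rewrite lee_fin|exact: hm].
Qed.

(** Annuli and terms are cut at the same [K], as in the Hardy inequalities; padding with zeros then
    makes the two cuts independent. *)
Lemma sum_integral_Hsum_le a K :
  (\sum_(0 <= n < K) \int[mu]_(z in Omega g n) (cabs (Hsum g v a z K) ^+ 2)%:E <=
   (B * \sum_(0 <= l < K) cabs (a l) ^+ 2 * v l)%:E)%E.
Proof.
apply: (@le_trans _ _ (\sum_(0 <= n < K)
   (3 * c ^- 2 * (w n * (\sum_(0 <= l < n) cabs (a l) * v l) ^+ 2)
    + 3 * M1 * (cabs (a n) ^+ 2 * v n)
    + 3 * c ^- 2 * (m n * (\sum_(n.+1 <= l < K) cabs (a l) * r l * u l) ^+ 2))%:E)%E).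
  rewrite big_nat [leRHS]big_nat; apply: lee_sum => n /= nK.
  exact: integral_Omega_Hsum_le.
rewrite sumEFin lee_fin !big_split /= -!mulr_sumr.
have c2 : 0 <= 3 * c ^- 2 by rewrite mulr_ge0 // invr_ge0 sqr_ge0.
have h1 := @hardy _ (fun l => cabs (a l)) v w K M2 M2_ge0
  (fun l => cabs_ge0 _) v_pos w_ge0 (fun n _ => hV n K).
have h2 := @hardy_dual _ (fun l => cabs (a l) * r l) (fun l => u l) m K M2 M2_ge0
  (fun l => mulr_ge0 (cabs_ge0 _) (cabs_ge0 _)) u_gt0 m_ge0 (fun n _ => hU n K).
have E : \sum_(0 <= l < K) (cabs (a l) * r l) ^+ 2 * u l =
         \sum_(0 <= l < K) cabs (a l) ^+ 2 * v l.
  apply: eq_bigr => l _; have /lt0r_neq0 := r_gt0 g_neq0 l.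
  by move: (cabs (a l)) (r l) => x y y0; field.
rewrite E in h2.
have := lerD (ler_wpM2l c2 h1) (ler_wpM2l c2 h2).
rewrite /B; move: (c ^- 2) (\sum_(0 <= l < K) cabs (a l) ^+ 2 * v l).
by move=> d s; lra.
Qed.

Lemma integral_Hsum_le a N :
  (\int[mu]_z (cabs (Hsum g v a z N) ^+ 2)%:E <=
   (B * \sum_(0 <= l < N) cabs (a l) ^+ 2 * v l)%:E)%E.
Proof.
have fge0 k : (0 <= \int[mu]_(z in Omega g k) (cabs (Hsum g v a z N) ^+ 2)%:E)%E.
  by apply: Omega_integral_ge0 => z; exact: sqr_ge0.
rewrite (integral_Omega mu g_neq0 q_gt1 g_sparse); last 2 first.
- by apply/measurable_EFinP; exact: measurable_sqr_Hsum.
- by move=> z; rewrite lee_fin sqr_ge0.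
apply: nneseries_le => // K.
pose a' l := if (l < N)%N then a l else 0.
pose L := maxn K N.
have NL : (N <= L)%N by exact: leq_maxr.
have KL : (K <= L)%N by exact: leq_maxl.
have Ea z : Hsum g v a' z L = Hsum g v a z N.
  rewrite /Hsum (@big_cat_nat _ _ _ N) //= [X in _ + X]big1_seq ?addr0.
    by apply: eq_big_nat => l /andP[_ lN]; rewrite /Hterm /a' lN.
  move=> l /= /[!mem_index_iota] /andP[Nl _].
  by rewrite /Hterm /a' ltnNge Nl !mul0r.
have Es : \sum_(0 <= l < L) cabs (a' l) ^+ 2 * v l = \sum_(0 <= l < N) cabs (a l) ^+ 2 * v l.
  rewrite (@big_cat_nat _ _ _ N) //= [X in _ + X]big1_seq ?addr0.
    by apply: eq_big_nat => l /andP[_ lN]; rewrite /a' lN.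
  move=> l /= /[!mem_index_iota] /andP[Nl _].
  by rewrite /a' ltnNge Nl cabs0 expr0n mul0r.
have := sum_integral_Hsum_le a' L; rewrite Es; apply: le_trans.
rewrite [leRHS](@big_cat_nat _ _ _ K) //=.
have E k : (\int[mu]_(z in Omega g k) (cabs (Hsum g v a' z L) ^+ 2)%:E =
            \int[mu]_(z in Omega g k) (cabs (Hsum g v a z N) ^+ 2)%:E)%E.
  by apply: eq_integral => z _; rewrite Ea.
under [X in (_ <= X + _)%E]eq_bigr do rewrite E.
by rewrite leeDl // sume_ge0 // => k _; rewrite E.
Qed.

Lemma H_bounded_of_weights : H_bounded mu g v.
Proof.
exists B => a an.
have an0 l : (0 <= (cabs (a l) ^+ 2 * v l)%:E)%E.
  by rewrite lee_fin mulr_ge0 ?sqr_ge0 // ltW.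
have nn0 : (0 <= ell2v_norm2 v a)%E by apply: nneseries_ge0 => l _ _; exact: an0.
have nfin : ell2v_norm2 v a \is a fin_num by rewrite ge0_fin_numE.
have hS N : \sum_(0 <= l < N) cabs (a l) ^+ 2 * v l <= fine (ell2v_norm2 v a).
  rewrite -lee_fin fineK // -sumEFin; apply: nneseries_lim_ge => l _ _; exact: an0.
have B0 : 0 <= B.
  rewrite /B mulr_ge0 // addr_ge0 // mulr_ge0 ?invr_ge0 ?sqr_ge0 // mulr_ge0 //.
pose f N z := (cabs (Hsum g v a z N) ^+ 2)%:E.
(* The partial sums converge at every z: at a pole the division by zero makes that term 0. *)
have Hlim z : (cabs (Hop g v a z) ^+ 2)%:E = limn_einf (f ^~ z).
  apply/esym; have cRe := @is_cvg_Hterm _ g v q g_neq0 q_gt1 g_sparse v_pos a z _ _ hS hT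
    _ (@ler_normRe_cabs R).
  have cIm := @is_cvg_Hterm _ g v q g_neq0 q_gt1 g_sparse v_pos a z _ _ hS hT
    _ (@ler_normIm_cabs R).
  have : f ^~ z @ \oo --> (cabs (Hop g v a z) ^+ 2)%:E.
    apply: cvg_EFin; first by near=> N.
    rewrite sqr_cabs /=.
    have -> : fine \o f ^~ z = fun N => (\sum_(0 <= l < N) complex.Re (Hterm g v a z l)) ^+ 2
       + (\sum_(0 <= l < N) complex.Im (Hterm g v a z l)) ^+ 2.
      by apply/funext => N; rewrite /f /= sqr_cabs Re_sum Im_sum.
    apply: cvgD; rewrite !expr2; apply: cvgM => //.
  by move=> fl; rewrite is_cvg_limn_einfE; [exact/cvg_lim|apply/cvg_ex; eexists; exact: fl].
under eq_integral do rewrite Hlim.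
apply: le_trans (fatou mu measurableT _ _) _.
- by move=> N; apply/measurable_EFinP; exact: measurable_sqr_Hsum.
- by move=> N z _; rewrite lee_fin sqr_ge0.
rewrite limn_einf_lim; apply: lime_le; first exact: is_cvg_einfs.
near=> N; apply: (@le_trans _ _ (\int[mu]_z f N z)%E).
  by apply: ereal_inf_lbound; exists N => /=.
apply: le_trans (integral_Hsum_le _ _) _.
by rewrite -(fineK nfin) -EFinM lee_fin ler_wpM2l.
Unshelve. all: by end_near. Qed.

End Sufficiency.

Lemma fin_num_of_mule_le (R : realType) (a x : \bar R) (M : R) :
  (0 < a -> 0 <= x -> a * x <= M%:E -> x \is a fin_num)%E.
Proof.
move=> a0 x0; rewrite ge0_fin_numE // ltey.
by apply: contraTN => /eqP ->; rewrite gt0_muley.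
Qed.

(** * From the two conditions to real weights *)

Section Weights.
Variables (R : realType) (mu : {measure set (R * R)%type -> \bar R}).
Variables (g : nat -> R[i]) (v : nat -> R) (q : R).
Hypotheses (g_neq0 : forall n, g n != 0) (q_gt1 : 1 < q).
Hypothesis g_sparse : forall n, q <= cabs (g n.+1) / cabs (g n).
Hypothesis v_pos : forall n, 0 < v n.
Hypothesis v_adm : (\sum_(0 <= n <oo) (v n / (1 + cabs (g n) ^+ 2))%:E < +oo)%E.
Local Notation r n := (cabs (g n)).
Local Notation u n := (v n / r n ^+ 2).

(** Since r_l >= r_0, the ratio (1 + r_l^2) / r_l^2 is at most 1 + r_0^-2. *)
Lemma admissible_sum_le : exists T, forall N, \sum_(0 <= l < N) u l <= T.
Proof.
pose f n := v n / (1 + r n ^+ 2).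
have D0 n : 0 < 1 + r n ^+ 2 by rewrite ltr_pwDl // sqr_ge0.
have f0 n : 0 <= f n by rewrite divr_ge0 ?ltW.
have s0 : (0 <= \sum_(0 <= n <oo) (f n)%:E)%E.
  by apply: nneseries_ge0 => n _ _; rewrite lee_fin.
have sfin : (\sum_(0 <= n <oo) (f n)%:E)%E \is a fin_num by rewrite ge0_fin_numE.
have k0 : 0 <= 1 + r 0 ^- 2 by rewrite addr_ge0 // invr_ge0 sqr_ge0.
exists ((1 + r 0 ^- 2) * fine (\sum_(0 <= n <oo) (f n)%:E)) => N.
apply: (@le_trans _ _ ((1 + r 0 ^- 2) * \sum_(0 <= n < N) f n)); last first.
  rewrite ler_wpM2l // -lee_fin fineK // -sumEFin.
  by apply: nneseries_lim_ge => n _ _; rewrite lee_fin.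
rewrite mulr_sumr; apply: ler_sum => l _.
rewrite mulrCA ler_pM2l // ler_pdivlMr // mulrC -ler_pdivlMr ?invr_gt0 ?exprn_gt0 ?cabs_gt0 //.
rewrite invrK mulrDl mul1r addrC lerD2l.
rewrite mulrC ler_pdivlMr ?mul1r ?exprn_gt0 ?cabs_gt0 //.
by rewrite ler_sqr ?nnegrE ?cabs_ge0 // (r_mono g_neq0 q_gt1 g_sparse).
Qed.

(** The Hardy inequalities concern real weights, so the integrals and masses must be finite. Each is
    part of a bounded product whose other factor is positive. *)
Lemma H_bounded_of_conditions (M1 M2 : R) :
  (forall n, (\int[mu]_(z in Omega g n) (v n / cabs (toC z - g n) ^+ 2)%:E <= M1%:E)%E) ->
  (forall n,
      ((\sum_(l < n.+1) (v l)%:E) *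
         (\sum_(n.+1 <= m <oo) \int[mu]_(z in Omega g m) (cabs (toC z) ^+ 2)^-1%:E)
       + (\sum_(m < n.+1) mu (Omega g m)) *
         (\sum_(n.+1 <= l <oo) (v l / cabs (g l) ^+ 2)%:E) <= M2%:E)%E) ->
  H_bounded mu g v.
Proof.
move=> hD h2; have [T hT] := admissible_sum_le.
pose W n := (\int[mu]_(z in Omega g n) (cabs (toC z) ^+ 2)^-1%:E)%E.
have W0 n : (0 <= W n)%E by apply: Omega_integral_ge0 => z; rewrite invr_ge0 sqr_ge0.
have u0 n : 0 < u n by exact: u_gt0.
have ue0 n : (0 <= (u n)%:E)%E by rewrite lee_fin ltW.
pose S n := (\sum_(m < n.+1) mu (Omega g m))%E.
have S0 n : (0 <= S n)%E by apply: sume_ge0.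
have EV n : (\sum_(l < n.+1) (v l)%:E = (\sum_(0 <= l < n.+1) v l)%:E)%E.
  by rewrite -(big_mkord xpredT (fun l => (v l)%:E)) sumEFin.
have V0 n : 0 < \sum_(0 <= l < n.+1) v l by exact: psum_gt0.
have tW0 n : (0 <= \sum_(n <= m <oo) W m)%E by apply: nneseries_ge0.
have tu0 n : (0 <= \sum_(n <= m <oo) (u m)%:E)%E by apply: nneseries_ge0.
have X0 n : (0 <= (\sum_(0 <= l < n.+1) v l)%:E * \sum_(n.+1 <= m <oo) W m)%E.
  by apply: mule_ge0 => //; rewrite lee_fin ltW.
have Y0 n : (0 <= S n * \sum_(n.+1 <= l <oo) (u l)%:E)%E by rewrite mule_ge0.
have hX n : ((\sum_(0 <= l < n.+1) v l)%:E * \sum_(n.+1 <= m <oo) W m <= M2%:E)%E.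
  by apply: le_trans (h2 n); rewrite EV; apply: leeDl; exact: Y0.
have hY n : (S n * \sum_(n.+1 <= l <oo) (u l)%:E <= M2%:E)%E.
  by apply: le_trans (h2 n); rewrite EV; apply: leeDr; exact: X0.
have tu_gt0 n : (0 < \sum_(n <= m <oo) (u m)%:E)%E.
  apply: (@lt_le_trans _ _ (\sum_(n <= m < n.+1) (u m)%:E)%E).
    by rewrite big_nat1 lte_fin.
  exact: nneseries_lim_ge.
have Wfin n : W n.+1 \is a fin_num.
  have V0' : (0 < (\sum_(0 <= l < 1) v l)%:E)%E by rewrite lte_fin.
  have tfin := fin_num_of_mule_le V0' (tW0 1%N) (hX 0%N).
  rewrite ge0_fin_numE //; apply: (@le_lt_trans _ _ (\sum_(1 <= m <oo) W m)%E).
    apply: (@le_trans _ _ (\sum_(1 <= m < n.+2) W m)%E); last exact: nneseries_lim_ge.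
    by rewrite big_nat_recr //= leeDr // sume_ge0.
  by rewrite -ge0_fin_numE.
have mfin n : mu (Omega g n) \is a fin_num.
  have := hY n; rewrite muleC => /(fin_num_of_mule_le (tu_gt0 _) (S0 _)) Sfin.
  rewrite ge0_fin_numE //; apply: (@le_lt_trans _ _ (S n)).
    by rewrite /S big_ord_recr /= leeDr // sume_ge0.
  by rewrite -ge0_fin_numE.
apply: (@H_bounded_of_weights R mu g v q g_neq0 q_gt1 g_sparse v_pos M1 M2 T
  (fun n => fine (W n)) (fun n => fine (mu (Omega g n)))) => //.
(* [M1], and [M2] after it, are nonnegative because they bound nonnegative quantities. *)
- rewrite -lee_fin; apply: le_trans (hD 0%N); apply: Omega_integral_ge0 => z.
  by rewrite divr_ge0 ?sqr_ge0 // ltW.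
- by rewrite -lee_fin; exact: le_trans (hX 0%N).
- by move=> n /=; rewrite fine_ge0.
- by move=> n /=; rewrite fineK.
- by move=> n /=; rewrite fineK.
- move=> n K; rewrite -lee_fin; apply: le_trans (hX n).
  rewrite EFinM; apply: lee_wpmul2l; first by rewrite lee_fin ltW.
  apply: le_trans (nneseries_lim_ge K _) => //.
  rewrite -sumEFin big_nat [leRHS]big_nat; apply: lee_sum => -[//|k] _.
  by rewrite fineK.
move=> n K; rewrite -lee_fin; apply: le_trans (hY n).
rewrite EFinM -(sumEFin _ _ (fun k => fine (mu (Omega g k)))).
have -> : (\sum_(0 <= k < n.+1) (fine (mu (Omega g k)))%:E = S n)%E.
  by rewrite /S -(big_mkord xpredT (fun k => mu (Omega g k))); apply: eq_bigr => k _; rewrite fineK.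
by apply: lee_wpmul2l => //; rewrite -sumEFin; exact: nneseries_lim_ge.
Qed.

End Weights.
Theorem theorem1 (R : realType) (g : nat -> R[i]) (v : nat -> R)
  (mu : {measure set (R * R)%type -> \bar R})
  (g_inj : injective g)
  (g_neq0 : forall n, g n != 0)
  (g_sparse : exists2 q : R, 1 < q & forall n, q <= cabs (g n.+1) / cabs (g n))
  (v_pos : forall n, 0 < v n)
  (v_adm : (\sum_(0 <= n <oo) (v n / (1 + cabs (g n) ^+ 2))%:E < +oo)%E)
  (mu_Gamma : mu [set z | exists n, toC z = g n] = 0%E) :
  H_bounded mu g v <->
  ((exists M : R, forall n,
      (\int[mu]_(z in Omega g n) (v n / cabs (toC z - g n) ^+ 2)%:E <= M%:E)%E)
   /\
   (exists M : R, forall n,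
      ((\sum_(l < n.+1) (v l)%:E) *
         (\sum_(n.+1 <= m <oo) \int[mu]_(z in Omega g m) (cabs (toC z) ^+ 2)^-1%:E)
       + (\sum_(m < n.+1) mu (Omega g m)) *
         (\sum_(n.+1 <= l <oo) (v l / cabs (g l) ^+ 2)%:E) <= M%:E)%E)).
Proof.
have [q q_gt1 sparse] := g_sparse; split=> [[C HC]|[[M1 hD] [M2 h2]]]; last first.
  exact: (H_bounded_of_conditions g_neq0 q_gt1 sparse v_pos v_adm hD h2).
split; first by exists C; exact: (diagonal_necessary g_neq0 q_gt1 sparse v_pos HC).
(* The two products are tested separately and their bounds added. *)
exists (4 * C + 4 * C) => n; rewrite EFinD; apply: leeD.
  exact: (lower_necessary g_neq0 q_gt1 sparse v_pos HC).
exact: (upper_necessary g_neq0 q_gt1 sparse v_pos HC).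
Qed.
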